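(* If $f(x;y)=\sum_{n=0}^\infty \alpha_n p_n(x)y^n$, then the partial sums $q_m(x;t)=\sum_{n=0}^m t^n\alpha_n p_n(x)$ have the generating function $$\sum_{m=0}^\infty q_m(x;t)\,y^m=\frac{f(x;ty)}{1-y}.$$
   Context: Let $(a_n)_{n\ge0}$, $(b_n)_{n\ge0}$, $(c_n)_{n\ge1}$ be real sequences with $a_n\neq 0$ for all $n$. The polynomials $p_n$ (of degree $n$) are determined by $x\,p_n(x)=a_n p_{n+1}(x)+b_n p_n(x)+c_n p_{n-1}(x)$ for $n\ge 0$, with $p_{-1}(x)=0$, $p_0(x)=1$ (the term $c_0p_{-1}$ being zero). Let $(\alpha_n)_{n\ge0}$ be a sequence of nonzero real numbers with $\alpha_0=1$, and let $t\in\mathbb{R}\setminus\{0\}$. Generating functions are understood as formal power series in $y$. *)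

(* Defs.v *)
From HB Require Import structures.
From mathcomp Require Import all_boot all_order all_algebra.
From mathcomp Require Import boolp classical_sets reals.

Set Implicit Arguments.
Unset Strict Implicit.
Unset Printing Implicit Defensive.

Import Order.TTheory GRing.Theory Num.Theory.

Local Open Scope ring_scope.

(** * Formal power series in one variable y

    [fps A] is A[[y]].  It is a record rather than an alias of [nat -> A] so
    that its product cannot be confused with the pointwise one. *)

Record fps (A : Type) := Fps { fcoef : nat -> A }.

HB.instance Definition _ (A : Type) := gen_eqMixin (fps A).
HB.instance Definition _ (A : Type) := gen_choiceMixin (fps A).

(** [\fps_ n E] is the series \sum_(n >= 0) E y^n. *)
Notation "\fps_ n E" := (Fps (fun n => E))
  (at level 36, n name, E at level 36, format "\fps_ n  E") : ring_scope.

Lemma fpsP (A : Type) (u v : fps A) : fcoef u =1 fcoef v <-> u = v.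
Proof.
case: u v => [u] [v]; split=> [/= uv|[->] //].
by congr Fps; apply/funext.
Qed.

Section FpsRing.
Variable A : comNzRingType.
Implicit Types u v w : fps A.

Definition fps_zero : fps A := \fps_ n 0.
Definition fps_opp u : fps A := \fps_ n (- fcoef u n).
Definition fps_add u v : fps A := \fps_ n (fcoef u n + fcoef v n).

Fact fps_addA : associative fps_add.
Proof. by move=> u v w; apply/fpsP => n /=; rewrite addrA. Qed.
Fact fps_addC : commutative fps_add.
Proof. by move=> u v; apply/fpsP => n /=; rewrite addrC. Qed.
Fact fps_add0 : left_id fps_zero fps_add.
Proof. by move=> u; apply/fpsP => n /=; rewrite add0r. Qed.
Fact fps_addN : left_inverse fps_zero fps_opp fps_add.
Proof. by move=> u; apply/fpsP => n /=; rewrite addNr. Qed.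

HB.instance Definition _ :=
  GRing.isZmodule.Build (fps A) fps_addA fps_addC fps_add0 fps_addN.

Definition fpsC (a : A) : fps A := \fps_ n (if n == 0%N then a else 0).

Definition fps_one : fps A := fpsC 1.
Definition fps_mul u v : fps A :=
  \fps_ n (\sum_(i < n.+1) fcoef u i * fcoef v (n - i)).

Let trunc m u : {poly A} := \poly_(i < m) fcoef u i.

Let coef_trunc m u v n : (n < m)%N ->
  (trunc m u * trunc m v)`_n = fcoef (fps_mul u v) n.
Proof.
move=> nm; rewrite coefM; apply: eq_bigr => i _; rewrite !coef_poly.
by rewrite (leq_ltn_trans _ nm) ?(leq_ltn_trans (leq_subr i n) nm) // -ltnS.
Qed.

Fact fps_mulC : commutative fps_mul.
Proof.
by move=> u v; apply/fpsP => n; rewrite -!(@coef_trunc n.+1) // mulrC.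
Qed.

Fact fps_mulA : associative fps_mul.
Proof.
move=> u v w; apply/fpsP => n.
transitivity ((trunc n.+1 u * (trunc n.+1 v * trunc n.+1 w))`_n).
  rewrite coefM; apply: eq_bigr => i _; rewrite coef_poly ltn_ord.
  by rewrite coef_trunc // ltnS leq_subr.
rewrite mulrA coefM; apply: eq_bigr => i _.
by rewrite coef_poly coef_trunc // ltnS leq_subr.
Qed.

Fact fps_mul1 : left_id fps_one fps_mul.
Proof.
move=> u; apply/fpsP => n /=; rewrite big_ord_recl /= mul1r subn0.
by rewrite big1 ?addr0 // => i _; rewrite mul0r.
Qed.

Fact fps_mulDl : left_distributive fps_mul fps_add.
Proof.
move=> u v w; apply/fpsP => n /=; rewrite -big_split /=.
by apply: eq_bigr => i _; rewrite mulrDl.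
Qed.

Fact fps_one_neq0 : fps_one != 0.
Proof.
apply/eqP => /(congr1 (fun u => fcoef u 0)) /= /eqP.
by rewrite oner_eq0.
Qed.

HB.instance Definition _ :=
  GRing.Zmodule_isComNzRing.Build (fps A)
    fps_mulA fps_mulC fps_mul1 fps_mulDl fps_one_neq0.

(** The inverse of a unit is its inverse for the Cauchy product; following the
    MathComp convention, a non-unit is mapped to itself. *)
Definition fps_unit : {pred fps A} := [pred u | `[< exists v, v * u = 1 >]].
Definition fps_inv u : fps A := xget u [set v | v * u = 1]%classic.

Fact fps_mulVx : {in fps_unit, left_inverse 1 fps_inv *%R}.
Proof.
move=> u /asboolP[v vu]; rewrite /fps_inv.
by case: xgetP => [w _ //|/(_ v)].
Qed.
Fact fps_unitPl u v : v * u = 1 -> fps_unit u.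
Proof. by move=> vu; apply/asboolP; exists v. Qed.
Fact fps_inv_out : {in [predC fps_unit], fps_inv =1 id}.
Proof.
move=> u /asboolPn nu; rewrite /fps_inv.
by case: xgetP => [w _ wu|//]; case: nu; exists w.
Qed.

HB.instance Definition _ :=
  GRing.ComNzRing_hasMulInverse.Build (fps A)
    fps_mulVx fps_unitPl fps_inv_out.

Definition fpsX : fps A := \fps_ n (n == 1%N)%:R.

(** Substitution of v for y in u, meaningful when v has zero constant
    coefficient: v ^+ k then only contributes to coefficients n >= k, so that
    the coefficient of y^n in \sum_k u_k v^k is the finite sum below. *)
Definition fps_comp u v : fps A :=
  \fps_ n (\sum_(k < n.+1) fcoef u k * fcoef (v ^+ k) n).

(** Hence division by 1 - y is genuine. *)
Lemma fps_1BX_unit : 1 - fpsX \is a GRing.unit.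
Proof.
apply: (@fps_unitPl _ (\fps_ n 1)); rewrite mulrC; apply/fpsP => -[|n] /=.
  by rewrite big_ord1 /= subr0 mulr1.
rewrite big_ord_recl big_ord_recl /= subr0 sub0r !mulr1 big1 => [|i _].
  by rewrite addr0 subrr.
by rewrite /= subrr.
Qed.

End FpsRing.

Arguments fpsX {A}.

(** * Polynomials given by a three-term recurrence

    The value [c 0] multiplies p_(-1) = 0 and is irrelevant. *)
Definition three_term_recurrence (R : realType) (a b c : nat -> R)
    (p : nat -> {poly R}) : Prop :=
  p 0%N = 1 /\
  forall n : nat, 'X * p n =
    a n *: p n.+1 + b n *: p n + c n *: (if n is k.+1 then p k else 0).

(* Main.v *)
Require Import Defs.
From HB Require Import structures.
From mathcomp Require Import all_boot all_order all_algebra.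
From mathcomp Require Import boolp classical_sets reals.

Import Order.TTheory GRing.Theory Num.Theory.

Local Open Scope ring_scope.

(** Both sides are compared coefficient by coefficient.  Replacing y by a y
    multiplies the coefficient of y^n by a^n, because the n-th power of a y is
    the single monomial a^n y^n ([fcoef_comp_scaleX]).  Dividing by 1 - y turns
    a sequence of coefficients into its partial sums, because multiplying by
    1 - y takes consecutive differences, which telescope
    ([fps_partial_sums]).  Applied to f, these two facts give
    \sum_(n <= m) t^n alpha_n p_n = q_m as the coefficient of y^m. *)

Section FpsCoefficients.
Variable A : comNzRingType.
Implicit Types (a : A) (u : fps A).

Lemma fcoef_mulC a u n : fcoef (fpsC a * u) n = a * fcoef u n.
Proof.
rewrite /= big_ord_recl /= subn0 big1 ?addr0 // => i _.
by rewrite mul0r.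
Qed.

Lemma fcoef_mulX u n :
  fcoef (fpsX * u) n = if n is k.+1 then fcoef u k else 0.
Proof.
case: n => [|n] /=; first by rewrite big_ord1 mul0r.
rewrite !big_ord_recl /= mul0r add0r mul1r subSS subn0 big1 ?addr0 // => i _.
by rewrite mul0r.
Qed.

Lemma fcoef_exp_scaleX a k n :
  fcoef ((fpsC a * fpsX) ^+ k) n = if n == k then a ^+ k else 0.
Proof.
elim: k n => [|k IHk] n; first by rewrite expr0.
rewrite exprS -mulrA fcoef_mulC fcoef_mulX.
case: n => [|n]; first by rewrite mulr0.
by rewrite IHk eqSS; case: eqP => _; rewrite ?mulr0 // exprS.
Qed.

(** Only the term of index n of the composition sum reaches y^n, the other
    powers of a y being monomials of a different degree. *)
Lemma fcoef_comp_scaleX u a n :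
  fcoef (fps_comp u (fpsC a * fpsX)) n = fcoef u n * a ^+ n.
Proof.
rewrite [LHS]/= big_ord_recr /= fcoef_exp_scaleX eqxx big1 ?add0r // => i _.
by rewrite fcoef_exp_scaleX gtn_eqF ?mulr0.
Qed.

(** Since 1 - y is invertible it suffices to multiply the series of partial
    sums by it, and the difference of two consecutive partial sums is a
    coefficient of u. *)
Lemma fps_partial_sums u :
  \fps_ m (\sum_(0 <= n < m.+1) fcoef u n) = u / (1 - fpsX).
Proof.
apply: (canRL (mulrK (fps_1BX_unit A))); apply/fpsP => n.
set v := Fps _; rewrite mulrC mulrBl mul1r.
rewrite -[LHS]/(fcoef v n - fcoef (fpsX * v) n) fcoef_mulX.
case: n => [|n] /=; first by rewrite big_nat1 subr0.
by rewrite big_nat_recr //= addrC addrK.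
Qed.

End FpsCoefficients.

Theorem lemma2p9 (R : realType) (a b c : nat -> R) (p : nat -> {poly R})
    (alpha : nat -> R) (t : R) (f : fps {poly R}) (q : nat -> {poly R})
    (ha : forall n : nat, a n != 0)
    (hp : three_term_recurrence a b c p)
    (halpha : forall n : nat, alpha n != 0)
    (halpha0 : alpha 0%N = 1)
    (ht : t != 0)
    (hf : f = \fps_ n (alpha n *: p n))
    (hq : forall m : nat,
        q m = \sum_(0 <= n < m.+1) (t ^+ n * alpha n) *: p n) :
  \fps_ m (q m) = fps_comp f (fpsC t%:P * fpsX) / (1 - fpsX).
Proof.
rewrite -fps_partial_sums; apply/fpsP => m.
rewrite [LHS]hq; apply: eq_bigr => n _.
(* The powers of t live among the constant polynomials on the right, and act as
   scalars on the left. *)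
by rewrite fcoef_comp_scaleX hf /= -polyC_exp [RHS]mulrC mul_polyC scalerA.
Qed.
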